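(* Let $(\tau_n)_{n\ge 1}$ be a Markov chain with values in $\{0,1\}$, with initial probabilities $p_0>0$, $p_1>0$ ($p_0+p_1=1$) and with transition matrix $\begin{pmatrix} p_{00} & p_{01}\\ p_{10} & p_{11}\end{pmatrix}$, and let $\tau=\Delta^{G_2}_{\tau_1\tau_2\ldots\tau_n\ldots}$. If none of the entries of the transition matrix is zero, then the distribution of $\tau$ is pure continuous, and it is absolutely continuous only if $p_{ij}=|g_j|$ for all $i,j\in\{0,1\}$. Moreover, if $p_{ij}=|g_j|$ for all $i,j\in\{0,1\}$ and $p_0=g_0$, then the distribution of $\tau$ is the uniform distribution on $[0,g_0]$.
   Context: Fix a real number $g_0\in[\frac12,1)$ and put $g_1=g_0-1$, $\delta_0=0$, $\delta_1=g_0$. For a sequence $(\alpha_n)_{n\ge1}$ of elements of $\{0,1\}$ put $$\Delta^{G_2}_{\alpha_1\alpha_2\ldots\alpha_n\ldots}=\delta_{\alpha_1}+\sum_{k=2}^\infty \delta_{\alpha_k}\prod_{j=1}^{k-1}g_{\alpha_j}\in[0,g_0].$$ Every $x\in[0,g_0]$ equals $\Delta^{G_2}_{\alpha_1\alpha_2\ldots}$ for some sequence of zeros and ones. The symbol $p_{ij}$ denotes the transition probability $P\{\tau_{n+1}=j\mid\tau_n=i\}$ (rows of the matrix sum to $1$). A distribution is pure continuous if it has no atoms; absolute continuity is with respect to Lebesgue measure. *)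

(* Defs.v *)
From HB Require Import structures.
From mathcomp Require Import all_boot all_order all_algebra.
From mathcomp Require Import all_classical all_reals all_analysis.
From mathcomp Require Import measurable_realfun.

Set Implicit Arguments.
Unset Strict Implicit.
Unset Printing Implicit Defensive.

Import Order.TTheory GRing.Theory Num.Theory.
Import numFieldNormedType.Exports.

Local Open Scope classical_set_scope.
Local Open Scope ring_scope.

(* The alphabet {0,1} is [bool] (with its discrete sigma-algebra): [false] is 0
   and [true] is 1.  Sequences indexed by n >= 1 are indexed here by n >= 0, so
   that [alpha n] is the (n+1)-st digit. *)

Section G2_representation.
Context {R : realType}.
Implicit Types (alpha : nat -> bool).

Definition gcoef (g0 : R) (i : bool) : R := if i then g0 - 1 else g0.

Definition delta (g0 : R) (i : bool) : R := if i then g0 else 0.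

Definition G2_term (g0 : R) alpha : R^nat :=
  fun k => delta g0 (alpha k) * \prod_(j < k) gcoef g0 (alpha j).

Definition G2 (g0 : R) alpha : R := limn (series (G2_term g0 alpha)).

Lemma half_le_gt0 (g0 : R) : 2^-1 <= g0 < 1 -> 0 < g0.
Proof. by case/andP=> h _; apply: lt_le_trans h; rewrite invr_gt0. Qed.

Lemma gcoef_norm_le (g0 : R) i : 2^-1 <= g0 < 1 -> `|gcoef g0 i| <= g0.
Proof.
move=> hg; have g0_gt0 := half_le_gt0 hg; case/andP: hg => hg1 hg2.
case: i; rewrite /gcoef; last by rewrite ger0_norm // ltW.
rewrite distrC ger0_norm; last by rewrite subr_ge0 ltW.
rewrite lerBlDr -mulr2n -mulr_natr -ler_pdivrMr ?ltr0n //.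
by rewrite div1r.
Qed.

Lemma G2_cvg (g0 : R) alpha :
  2^-1 <= g0 < 1 -> series (G2_term g0 alpha) @ \oo --> G2 g0 alpha.
Proof.
move=> hg; have g0_gt0 := half_le_gt0 hg.
apply: normed_cvg.
apply: (@series_le_cvg _ _ (geometric g0 g0)) => //= [n|n|].
- by rewrite mulr_ge0 ?exprn_ge0 ?ltW.
- rewrite /G2_term normrM normr_prod ler_pM ?prodr_ge0 //.
    by rewrite /delta; case: (alpha n); rewrite ?normr0 ?ger0_norm // ltW.
  rewrite -[leRHS]/(g0 ^+ n) -[in leRHS](card_ord n) -prodr_const.
  by apply: ler_prod => i _; rewrite normr_ge0 gcoef_norm_le.
- apply: is_cvg_geometric_series; rewrite ger0_norm ?ltW //.
  by case/andP: hg.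
Qed.

End G2_representation.

Section markov_chain.
Context {d : measure_display} {T : measurableType d} {R : realType}.
Variable P : probability T R.

Definition cond_prob (A B : set T) : R := fine (P (A `&` B)) / fine (P B).

Variable tau : nat -> {RV P >-> bool}.

(* The event that the state number n is i. *)
Definition visits n (i : bool) : set T := tau n @^-1` [set i].

(* As usual, conditional probabilities are constrained only when the
   conditioning event has positive probability. *)
Definition markov_property : Prop :=
  forall (n : nat) (s : nat -> bool) (j : bool),
    let past := \bigcap_(k in `I_n.+1) visits k (s k) in
    (0 < P past)%E ->
    cond_prob (visits n.+1 j) past
    = cond_prob (visits n.+1 j) (visits n (s n)).

Definition is_markov_chain (p0 : bool -> R) (p : bool -> bool -> R) : Prop :=
  [/\ forall i, P (visits 0 i) = (p0 i)%:E,
      markov_property &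
      forall n i j, (0 < P (visits n i))%E ->
        cond_prob (visits n.+1 j) (visits n i) = p i j].

End markov_chain.

Section G2_random_variable.
Context {d : measure_display} {T : measurableType d} {R : realType}.
Variables (P : probability T R) (tau : nat -> {RV P >-> bool}).
Variables (g0 : R) (hg0 : 2^-1 <= g0 < 1).

Definition G2_fun (w : T) : R := G2 g0 (fun n => tau n w).

Lemma measurable_G2_fun : measurable_fun [set: T] G2_fun.
Proof.
have mcomp (f : bool -> R) n : measurable_fun [set: T] (fun w => f (tau n w)).
  apply: (@measurableT_comp _ _ _ _ _ _ f) => //.
apply: (@measurable_fun_cvg _ _ _ _
  (fun n w => series (G2_term g0 (fun k => tau k w)) n)) => [n|w _].
- apply: measurable_sum => k; apply: measurable_funM; first exact: mcomp.
  by apply: measurable_prod => i _; exact: mcomp.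
- exact: G2_cvg.
Qed.

Definition G2_RV : {RV P >-> R} :=
  HB.pack_for {mfun T >-> R} G2_fun
    (isMeasurableFun.Build _ _ _ _ G2_fun measurable_G2_fun).

End G2_random_variable.

(* Main.v *)
Require Import Defs.
From HB Require Import structures.
From mathcomp Require Import all_boot all_order all_algebra.
From mathcomp Require Import all_classical all_reals all_analysis.
From mathcomp Require Import measurable_realfun.
From mathcomp Require Import ring lra.

Set Implicit Arguments.
Unset Strict Implicit.
Unset Printing Implicit Defensive.

Import Order.TTheory GRing.Theory Num.Theory.
Import numFieldNormedType.Exports.

Local Open Scope classical_set_scope.
Local Open Scope ring_scope.

(** The cylinder of a finite word [w], that is the set of the numbers with a
    representation starting with [w], is a closed interval of length
    [g0 * \prod_(i <- w) |g_i|] ([cyl_length]), and cylinders of the same length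
    overlap at end points only.  The chain starts with [w] with a probability that
    is a product of transition probabilities ([prob_past]).  Hence, if [Q] holds
    for all the words of length [n] whose cylinder meets a Borel set [A], then
    the law of the random variable gives [A] at most the sum of the
    probabilities of the words satisfying [Q] ([law_le_word_mass]).  The three
    claims come from three choices of [A] and [Q].

    - No atoms.  A point lies in at most two cylinders of each length
      ([cyl_count_le2]), and each of them has a probability that decays
      geometrically, because the transition probabilities are less than 1.

    - Absolute continuity.  For independent digits of law [|g_j|] the
      probability of a word is the relative length of its cylinder.  The
      affinity of that law with the law of the chain, the sum over the words of
      the square roots of the products of the two probabilities, is governed by
      the matrix with entries [sqrt (p_ij |g_j|)].  By the inequality of the
      arithmetic and geometric means its row sums are at most 1, and smaller
      than 1 for a row of [p] other than [|g|]; all its entries being positive,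
      the affinity decays geometrically as soon as there is such a row
      ([affinity_decay]).  So the union of the cylinders whose probability
      for the chain is at least their relative length has small Lebesgue measure and a
      probability close to 1.  By the Borel-Cantelli lemma, the upper limit of
      these unions is Lebesgue null and has probability 1
      ([law_not_dominated]).

    - Uniform law.  If [p_ij = |g_j|] and [p_0 = g0], the probability of a word
      is the relative length of its cylinder.  The cylinders meeting [0, a], and
      those meeting [a, g0], have total relative length at most [a / g0], and
      [(g0 - a) / g0], up to [g0 ^+ n] ([cyl_ratio_below_above]).  Letting [n]
      grow bounds the distribution function from both sides. *)

(** * Binary words *)

(** All words of length [n] over the alphabet {0,1}, each listed once, sorted
    by their first letter so that sums over them obey [sum_words]. *)
Fixpoint words n : seq (seq bool) :=
  if n is n'.+1
  then [seq false :: w | w <- words n'] ++ [seq true :: w | w <- words n']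
  else [:: [::]].

Lemma mem_words n w : (w \in words n) = (size w == n).
Proof.
elim: n w => [|n IHn] [|i w] //=; rewrite mem_cat.
  by apply/negbTE; rewrite negb_or; apply/andP; split; apply/mapP => -[].
have inj j : injective (cons j : seq bool -> seq bool) by move=> ? ? [].
rewrite eqSS -IHn; case: i; rewrite (mem_map (@inj _)).
  by rewrite orb_idl // => /mapP[].
by rewrite orb_idr // => /mapP[].
Qed.

Lemma sum_words (V : nmodType) n (Q : pred (seq bool)) (F : seq bool -> V) :
  \sum_(w <- words n.+1 | Q w) F w =
  \sum_(w <- words n | Q (false :: w)) F (false :: w) +
  \sum_(w <- words n | Q (true :: w)) F (true :: w).
Proof. by rewrite big_cat !big_map. Qed.

Lemma sum_words0 (V : nmodType) (Q : pred (seq bool)) (F : seq bool -> V) :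
  \sum_(w <- words 0 | Q w) F w = if Q [::] then F [::] else 0.
Proof. by rewrite /= big_mkcond /= big_seq1. Qed.

Lemma mkseq_cons (alpha : nat -> bool) n :
  mkseq alpha n.+1 = alpha 0%N :: mkseq (fun k => alpha k.+1) n.
Proof. by rewrite /mkseq /= -[1%N]addn0 iotaDl -map_comp. Qed.

(** * Cylinder intervals *)

Section cylinders.
Context {R : realType}.
Variable g0 : R.
Hypothesis hg0 : 2^-1 <= g0 < 1.
Implicit Types (w : seq bool) (alpha : nat -> bool) (x : R).

(** The end points of the cylinder interval of [w], the image of [0, g0] under
    the composition of the affine maps x |-> delta_i + g_i x along [w].  The map
    of the digit 1 reverses the orientation and so exchanges the end points. *)
Fixpoint cyl_ends w : R * R :=
  if w is i :: w' then
    let e := cyl_ends w' in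
    if i then (g0 + (g0 - 1) * e.2, g0 + (g0 - 1) * e.1)
    else (g0 * e.1, g0 * e.2)
  else (0, g0).

Definition cyl_lo w : R := (cyl_ends w).1.
Definition cyl_hi w : R := (cyl_ends w).2.

(** The length of the cylinder interval of [w], relative to that of [0, g0]. *)
Definition cyl_ratio w : R := \prod_(i <- w) `|gcoef g0 i|.

Lemma cyl_lo0 w : cyl_lo (false :: w) = g0 * cyl_lo w. Proof. by []. Qed.
Lemma cyl_hi0 w : cyl_hi (false :: w) = g0 * cyl_hi w. Proof. by []. Qed.
Lemma cyl_lo1 w : cyl_lo (true :: w) = g0 + (g0 - 1) * cyl_hi w.
Proof. by []. Qed.
Lemma cyl_hi1 w : cyl_hi (true :: w) = g0 + (g0 - 1) * cyl_lo w.
Proof. by []. Qed.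

Let g0_gt0 : 0 < g0. Proof. exact: half_le_gt0. Qed.
Let g0_lt1 : g0 < 1. Proof. by case/andP: hg0. Qed.
Let g1_le : 1 - g0 <= g0.
Proof. by case/andP: hg0 => + _; lra. Qed.

Lemma gcoef_norm0 : `|gcoef g0 false| = g0.
Proof. by rewrite /= ger0_norm // ltW. Qed.

Lemma gcoef_norm1 : `|gcoef g0 true| = 1 - g0.
Proof. by rewrite /= distrC ger0_norm // subr_ge0 ltW. Qed.

Lemma gcoef_norm_gt0 i : 0 < `|gcoef g0 i|.
Proof. by case: i; rewrite ?gcoef_norm0 ?gcoef_norm1 // subr_gt0. Qed.

Lemma cyl_ratio_cons i w : cyl_ratio (i :: w) = `|gcoef g0 i| * cyl_ratio w.
Proof. by rewrite /cyl_ratio big_cons. Qed.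

Lemma cyl_ratio_nil : cyl_ratio [::] = 1.
Proof. by rewrite /cyl_ratio big_nil. Qed.

Lemma cyl_ratio_ge0 w : 0 <= cyl_ratio w.
Proof. exact: prodr_ge0. Qed.

Lemma sum_cyl_ratio n : \sum_(w <- words n) cyl_ratio w = 1.
Proof.
elim: n => [|n IHn]; first by rewrite sum_words0 cyl_ratio_nil.
rewrite sum_words.
under eq_bigr do rewrite cyl_ratio_cons.
under [X in _ + X]eq_bigr do rewrite cyl_ratio_cons.
by rewrite -!mulr_sumr IHn gcoef_norm0 gcoef_norm1; lra.
Qed.

Lemma cyl_ends_bounds w : [/\ 0 <= cyl_lo w, cyl_lo w <= cyl_hi w & cyl_hi w <= g0].
Proof.
elim: w => [|i w [l0 lh hg]]; first by split => //=; exact: ltW.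
case: i; rewrite ?(cyl_lo0, cyl_hi0, cyl_lo1, cyl_hi1).
  have hh : (1 - g0) * cyl_hi w <= g0.
    have h0 := le_trans l0 lh.
    by rewrite -[leRHS]mul1r ler_pM ?subr_ge0 // ?(ltW g0_lt1) //; lra.
  have := ler_wpM2l (_ : 0 <= 1 - g0) lh; rewrite subr_ge0 ltW // => /(_ isT) h2.
  have := mulr_ge0 (_ : 0 <= 1 - g0) l0; rewrite subr_ge0 ltW // => /(_ isT) h3.
  by split; lra.
split; first by rewrite mulr_ge0 // ltW.
  by rewrite ler_pM2l.
have h0 := le_trans l0 lh.
by rewrite -[leRHS]mul1r ler_pM ?(ltW g0_gt0, ltW g0_lt1).
Qed.

Lemma cyl_length w : cyl_hi w - cyl_lo w = g0 * cyl_ratio w.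
Proof.
elim: w => [|i w IHw]; first by rewrite cyl_ratio_nil mulr1 subr0.
rewrite cyl_ratio_cons mulrCA -IHw.
by case: i; rewrite ?gcoef_norm0 ?gcoef_norm1
  ?(cyl_lo0, cyl_hi0, cyl_lo1, cyl_hi1); ring.
Qed.

Lemma series_G2_termS alpha n :
  series (G2_term g0 alpha) n.+1 = delta g0 (alpha 0%N) +
    gcoef g0 (alpha 0%N) * series (G2_term g0 (fun k => alpha k.+1)) n.
Proof.
rewrite /series /= big_nat_recl // mulr_sumr {1}/G2_term big_ord0 mulr1.
congr (_ + _); apply: eq_bigr => k _.
by rewrite /G2_term big_ord_recl mulrCA.
Qed.

Lemma series_G2_term_bounds alpha n : 0 <= series (G2_term g0 alpha) n <= g0.
Proof.
elim: n alpha => [|n IHn] alpha.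
  by rewrite /series /= big_geq // lexx ltW.
rewrite series_G2_termS; have /andP[] := IHn (fun k => alpha k.+1).
set s := series _ _ => s0 s1.
have h1 : 0 <= (1 - g0) * s by rewrite mulr_ge0 // subr_ge0 ltW.
have h2 : 0 <= g0 * s by rewrite mulr_ge0 // ltW.
by case: (alpha 0%N) => /=; lra.
Qed.

Lemma G2_bounds alpha : 0 <= G2 g0 alpha <= g0.
Proof.
have cv := @G2_cvg R g0 alpha hg0; apply/andP; split.
  apply: (limr_ge (cvgP _ cv)); apply: nearW => n.
  by have /andP[] := series_G2_term_bounds alpha n.
apply: (limr_le (cvgP _ cv)); apply: nearW => n.
by have /andP[] := series_G2_term_bounds alpha n.
Qed.

(** Self-similarity of the representation. *)
Lemma G2_shift alpha :
  G2 g0 alpha = delta g0 (alpha 0%N) +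
    gcoef g0 (alpha 0%N) * G2 g0 (fun k => alpha k.+1).
Proof.
have cv := @G2_cvg R g0 (fun k => alpha k.+1) hg0.
apply/cvg_lim => //; rewrite -(cvg_shiftS (series (G2_term g0 alpha))).
rewrite (_ : (fun _ => _) = fun n => delta g0 (alpha 0%N) +
  gcoef g0 (alpha 0%N) * series (G2_term g0 (fun k => alpha k.+1)) n).
  by apply: cvgD; [exact: cvg_cst | apply: cvgMr].
by apply/funext => n; rewrite series_G2_termS.
Qed.

Lemma G2_in_cylinder alpha n :
  cyl_lo (mkseq alpha n) <= G2 g0 alpha <= cyl_hi (mkseq alpha n).
Proof.
elim: n alpha => [|n IHn] alpha; first exact: G2_bounds.
rewrite mkseq_cons G2_shift; have /andP[] := IHn (fun k => alpha k.+1).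
case: (alpha 0%N) => /=; rewrite ?(cyl_lo0, cyl_hi0, cyl_lo1, cyl_hi1).
  move=> /(ler_wpM2l (_ : 0 <= 1 - g0)); rewrite subr_ge0 ltW // => /(_ isT) h1.
  move=> /(ler_wpM2l (_ : 0 <= 1 - g0)); rewrite subr_ge0 ltW // => /(_ isT) h2.
  by lra.
by rewrite add0r !ler_pM2l // => -> ->.
Qed.

(** * Counting cylinders *)

(** The number of words of length [n] whose cylinder interval contains [x]. *)
Definition cyl_count n x : R :=
  \sum_(w <- words n | cyl_lo w <= x <= cyl_hi w) 1.

Lemma cyl_count_out n x : ~~ (0 <= x <= g0) -> cyl_count n x = 0.
Proof.
move=> xout; rewrite /cyl_count big_pred0 // => w; apply/negbTE.
apply: contra xout => /andP[lx xh]; have [l0 _ hg] := cyl_ends_bounds w.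
by rewrite (le_trans l0 lx) (le_trans xh hg).
Qed.

Lemma cyl_countS n x :
  cyl_count n.+1 x = cyl_count n (x / g0) + cyl_count n ((g0 - x) / (1 - g0)).
Proof.
have g1_gt0 : 0 < 1 - g0 by rewrite subr_gt0.
rewrite /cyl_count sum_words; congr (_ + _); apply: eq_bigl => w.
  by rewrite cyl_lo0 cyl_hi0 ler_pdivlMr // ler_pdivrMr // ![g0 * _]mulrC.
rewrite cyl_lo1 cyl_hi1 ler_pdivlMr // ler_pdivrMr // andbC.
by congr andb; apply/idP/idP => ?; lra.
Qed.

Lemma cyl_count0 n : cyl_count n 0 <= 1.
Proof.
elim: n => [|n IHn].
  by rewrite /cyl_count sum_words0; case: ifP.
rewrite cyl_countS mul0r subr0 (@cyl_count_out n (g0 / _)) ?addr0 // negb_and.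
apply/orP; right.
rewrite -ltNge ltr_pdivlMr ?subr_gt0 //.
by rewrite -[ltRHS]mulr1 ltr_pM2l // gtrBl.
Qed.

Lemma cyl_count_g0 n : cyl_count n g0 <= 1.
Proof.
case: n => [|n]; first by rewrite /cyl_count sum_words0; case: ifP.
rewrite cyl_countS subrr mul0r divff ?gt_eqF // (cyl_count_out n) ?add0r.
  exact: cyl_count0.
by rewrite negb_and -!ltNge g0_lt1 orbT.
Qed.

(** Cylinders of the same length only meet at their end points. *)
Lemma cyl_count_le2 n x : cyl_count n x <= 2.
Proof.
elim: n x => [|n IHn] x.
  by rewrite /cyl_count sum_words0; case: ifP => // _; rewrite ler1n.
have g1_gt0 : 0 < 1 - g0 by rewrite subr_gt0.
(* The images of [0, g0] under the two maps share the point g0^2 only. *)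
rewrite cyl_countS; have [xlt|xgt|->] := ltgtP x (g0 * g0).
- rewrite (@cyl_count_out n ((g0 - x) / _)) ?addr0 // negb_and -!ltNge.
  by apply/orP; right; rewrite ltr_pdivlMr //; lra.
- rewrite (@cyl_count_out n (x / g0)) ?add0r // negb_and -!ltNge.
  by apply/orP; right; rewrite ltr_pdivlMr.
- rewrite mulfK ?gt_eqF // (_ : (g0 - g0 * g0) / (1 - g0) = g0).
    by have := cyl_count_g0 n; lra.
  by field; rewrite gt_eqF.
Qed.

(** The two bounds go together: the digit 1 reverses the orientation, so that
    the induction step for each of them uses the other.  For each of them one
    of the two first digits contributes either nothing or everything, hence
    the error does not accumulate. *)
Lemma cyl_ratio_below_above n (a : R) :
  (0 <= a <= g0) ->
  \sum_(w <- words n | cyl_lo w <= a) cyl_ratio w <= a / g0 + g0 ^+ n /\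
  \sum_(w <- words n | a <= cyl_hi w) cyl_ratio w <= (g0 - a) / g0 + g0 ^+ n.
Proof.
have g1_gt0 : 0 < 1 - g0 by rewrite subr_gt0.
elim: n a => [|n IHn] a /andP[a0 ag].
  rewrite !sum_words0 cyl_ratio_nil a0 expr0; split.
    by rewrite ler_wpDl // divr_ge0 // ltW.
  by case: ifP => _; rewrite ?ler_wpDl // ?addr_ge0 // divr_ge0 // ?subr_ge0 // ltW.
have split_sum (Q : pred (seq bool)) :
    \sum_(w <- words n.+1 | Q w) cyl_ratio w =
    g0 * \sum_(w <- words n | Q (false :: w)) cyl_ratio w +
    (1 - g0) * \sum_(w <- words n | Q (true :: w)) cyl_ratio w.
  rewrite sum_words; congr (_ + _); rewrite mulr_sumr; apply: eq_bigr => w _;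
  by rewrite cyl_ratio_cons ?gcoef_norm0 ?gcoef_norm1.
have sum_le1 (Q : pred (seq bool)) : \sum_(w <- words n | Q w) cyl_ratio w <= 1.
  rewrite -(sum_cyl_ratio n) [leLHS]big_mkcond; apply: ler_sum => w _.
  by case: ifP => // _; exact: cyl_ratio_ge0.
have gn_ge0 : 0 <= g0 ^+ n by rewrite exprn_ge0 // ltW.
have e1 : (1 - g0) * g0 ^+ n <= g0 * g0 ^+ n by rewrite ler_wpM2r.
have lo0E w : (cyl_lo (false :: w) <= a) = (cyl_lo w <= a / g0).
  by rewrite cyl_lo0 ler_pdivlMr // mulrC.
have hi0E w : (a <= cyl_hi (false :: w)) = (a / g0 <= cyl_hi w).
  by rewrite cyl_hi0 ler_pdivrMr // mulrC.
have lo1E w : (cyl_lo (true :: w) <= a) = ((g0 - a) / (1 - g0) <= cyl_hi w).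
  by rewrite cyl_lo1 ler_pdivrMr //; apply/idP/idP => ?; lra.
have hi1E w : (a <= cyl_hi (true :: w)) = (cyl_lo w <= (g0 - a) / (1 - g0)).
  by rewrite cyl_hi1 ler_pdivlMr //; apply/idP/idP => ?; lra.
rewrite !split_sum exprS.
rewrite (eq_bigl _ _ lo0E) (eq_bigl _ _ lo1E) (eq_bigl _ _ hi0E) (eq_bigl _ _ hi1E).
set A := a / g0; set B := (g0 - a) / (1 - g0).
have A0 : 0 <= A by rewrite divr_ge0 // ltW.
have B0 : 0 <= B by rewrite divr_ge0 ?subr_ge0 // ltW.
have BE : (1 - g0) * (B / g0) = 1 - A.
  by rewrite /A /B; field; rewrite !gt_eqF.
have BE' : (1 - g0) * ((g0 - B) / g0) = A - g0.
  by rewrite /A /B; field; rewrite !gt_eqF.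
have AE : g0 * (A / g0) = A by rewrite mulrCA divff ?mulr1 // gt_eqF.
have AE' : g0 * ((g0 - A) / g0) = g0 - A by rewrite mulrCA divff ?mulr1 // gt_eqF.
have -> : (g0 - a) / g0 = 1 - A by rewrite mulrBl divff // gt_eqF.
have Ale : (A <= g0) = (a <= g0 * g0) by rewrite ler_pdivrMr.
have Ble : (B <= g0) = (g0 * g0 <= a).
  by rewrite ler_pdivrMr //; apply/idP/idP => ?; lra.
have none (Q : pred (seq bool)) : (forall w, Q w -> False) ->
    \sum_(w <- words n | Q w) cyl_ratio w = 0.
  by move=> noQ; rewrite big_pred0 // => w; apply/negbTE/negP => /noQ.
split.
- have [ag2|ag2] := leP (g0 * g0) a.
    have /IHn[_ IH] : 0 <= B <= g0 by rewrite B0 Ble.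
    have := ler_wpM2l (ltW g1_gt0) IH; rewrite mulrDr BE' => IH'.
    have := ler_wpM2l (ltW g0_gt0) (sum_le1 (fun w => cyl_lo w <= A)).
    by rewrite mulr1; lra.
  rewrite (none (fun w => B <= cyl_hi w)) ?mulr0 ?addr0; last first.
    move=> w; apply/negP; rewrite -ltNge.
    have [_ _ hg] := cyl_ends_bounds w; apply: le_lt_trans hg _.
    by rewrite ltNge Ble -ltNge.
  have /IHn[IH _] : 0 <= A <= g0 by rewrite A0 Ale ltW.
  by have := ler_wpM2l (ltW g0_gt0) IH; rewrite mulrDr AE.
- have [ag2|ag2] := leP a (g0 * g0).
    have /IHn[_ IH] : 0 <= A <= g0 by rewrite A0 Ale.
    have := ler_wpM2l (ltW g0_gt0) IH; rewrite mulrDr AE' => IH'.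
    have := ler_wpM2l (ltW g1_gt0) (sum_le1 (fun w => cyl_lo w <= B)).
    by rewrite mulr1; lra.
  rewrite (none (fun w => A <= cyl_hi w)) ?mulr0 ?add0r; last first.
    move=> w; apply/negP; rewrite -ltNge.
    have [_ _ hg] := cyl_ends_bounds w; apply: le_lt_trans hg _.
    by rewrite ltNge Ale -ltNge.
  have /IHn[IH _] : 0 <= B <= g0 by rewrite B0 Ble ltW.
  have := ler_wpM2l (ltW g1_gt0) IH; rewrite mulrDr BE.
  by lra.
Qed.

End cylinders.

(** * Masses of words *)

Section word_masses.
Context {R : realType}.
Variables (p0 : bool -> R) (p : bool -> bool -> R).
Implicit Types (w : seq bool) (s : nat -> bool).

(** The probability that a chain standing at [i] next runs through [w]. *)
Fixpoint path_mass i w : R :=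
  if w is j :: w' then p i j * path_mass j w' else 1.

(** The probability that the chain starts with the word [w]. *)
Definition word_mass w : R := if w is i :: w' then p0 i * path_mass i w' else 1.

Lemma path_mass_mkseq s n :
  path_mass (s 0%N) (mkseq (fun k => s k.+1) n) = \prod_(k < n) p (s k) (s k.+1).
Proof.
elim: n s => [|n IHn] s; first by rewrite big_ord0.
by rewrite mkseq_cons big_ord_recl /= (IHn (fun k => s k.+1)).
Qed.

Lemma word_mass_mkseq s n :
  word_mass (mkseq s n.+1) = p0 (s 0%N) * \prod_(k < n) p (s k) (s k.+1).
Proof. by rewrite mkseq_cons /= path_mass_mkseq. Qed.

Hypothesis p_ge0 : forall i j, 0 <= p i j.

Lemma path_mass_ge0 i w : 0 <= path_mass i w.
Proof. by elim: w i => [|j w IHw] i //=; rewrite mulr_ge0. Qed.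

Lemma path_mass_le c i w : (forall i j, p i j <= c) -> path_mass i w <= c ^+ size w.
Proof.
by move=> pc; elim: w i => [|j w IHw] i //=; rewrite exprS ler_pM ?path_mass_ge0.
Qed.

Hypothesis p0_ge0 : forall i, 0 <= p0 i.

Lemma word_mass_ge0 w : 0 <= word_mass w.
Proof. by case: w => [|i w] //=; rewrite mulr_ge0 ?path_mass_ge0. Qed.

End word_masses.

(** * Affinity between the chain and independent digits *)

Section affinity.
Context {R : realType}.
Variables (p0 q : bool -> R) (p : bool -> bool -> R).

(** The probability of a word for independent digits of law [q]; it is
    convertible to [cyl_ratio] when [q j = |g_j|]. *)
Definition iid_mass (w : seq bool) : R := \prod_(i <- w) q i.

Lemma iid_mass_cons i w : iid_mass (i :: w) = q i * iid_mass w.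
Proof. by rewrite /iid_mass big_cons. Qed.

Hypotheses (q_gt0 : forall i, 0 < q i) (q_sum : q false + q true = 1).
Hypotheses (p_gt0 : forall i j, 0 < p i j)
  (p_sum : forall i, p i false + p i true = 1).
Hypotheses (p0_ge0 : forall i, 0 <= p0 i) (p0_sum : p0 false + p0 true = 1).

(** The affinity (Bhattacharyya coefficient) of the laws of the first [n] steps
    of the chain after [i] and of [n] independent digits of law [q]. *)
Definition affinity i n : R :=
  \sum_(w <- words n) Num.sqrt (path_mass p i w * iid_mass w).

Lemma affinity0 i : affinity i 0 = 1.
Proof. by rewrite /affinity sum_words0 /= /iid_mass big_nil mul1r sqrtr1. Qed.

Lemma affinityS i n : affinity i n.+1 =
  Num.sqrt (p i false * q false) * affinity false n +
  Num.sqrt (p i true * q true) * affinity true n.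
Proof.
rewrite /affinity sum_words !mulr_sumr.
by congr (_ + _); apply: eq_bigr => w _;
  rewrite /= iid_mass_cons mulrACA sqrtrM // mulr_ge0 // ltW.
Qed.

Lemma affinity_ge0 i n : 0 <= affinity i n.
Proof. by apply: sumr_ge0 => w _; exact: sqrtr_ge0. Qed.

Lemma sqrtM_le_mean (a b : R) : 0 <= a -> 0 <= b ->
  Num.sqrt (a * b) <= (a + b) / 2.
Proof.
move=> a0 b0; rewrite -[leRHS]ger0_norm ?divr_ge0 ?addr_ge0 //.
rewrite -sqrtr_sqr ler_wsqrtr //.
have := sqr_ge0 (a - b); nra.
Qed.

Lemma sqrtM_lt_mean (a b : R) : 0 <= a -> 0 <= b -> a != b ->
  Num.sqrt (a * b) < (a + b) / 2.
Proof.
move=> a0 b0 ab; rewrite -[ltRHS]ger0_norm ?divr_ge0 ?addr_ge0 //.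
have : 0 < (a - b) ^+ 2 by rewrite exprn_even_gt0 // subr_eq0.
have -> : (a - b) ^+ 2 = 4 * (((a + b) / 2) ^+ 2 - a * b) by field.
rewrite pmulr_rgt0 // subr_gt0 => lt; rewrite -sqrtr_sqr ltr_sqrt //.
by apply: le_lt_trans lt; exact: mulr_ge0.
Qed.

Lemma affinity1_le1 i : affinity i 1 <= 1.
Proof.
rewrite affinityS !affinity0 !mulr1.
have := sqrtM_le_mean (ltW (p_gt0 i false)) (ltW (q_gt0 false)).
have := sqrtM_le_mean (ltW (p_gt0 i true)) (ltW (q_gt0 true)).
by have := p_sum i; have := q_sum; lra.
Qed.

Lemma affinity1_lt1 i j : p i j != q j -> affinity i 1 < 1.
Proof.
rewrite affinityS !affinity0 !mulr1 => pq.
have l j' := sqrtM_le_mean (ltW (p_gt0 i j')) (ltW (q_gt0 j')).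
have := sqrtM_lt_mean (ltW (p_gt0 i j)) (ltW (q_gt0 j)) pq.
by have := p_sum i; have := q_sum; case: j {pq}; have := l false; have := l true; lra.
Qed.

(** One row of the transition matrix differing from [q] makes the affinity
    drop in two steps from either state, since the chain may visit that row. *)
Lemma affinity2_lt1 i j k : p i j != q j -> affinity k 2 < 1.
Proof.
move=> /affinity1_lt1 lt1; have := affinity1_le1 k.
rewrite affinityS !affinity0 !mulr1 (affinityS k 1).
have sq_gt0 j' : 0 < Num.sqrt (p k j' * q j') by rewrite sqrtr_gt0 mulr_gt0.
have h j' : Num.sqrt (p k j' * q j') * affinity j' 1 <= Num.sqrt (p k j' * q j').
  by rewrite -[leRHS]mulr1 ler_pM2l // affinity1_le1.
have : Num.sqrt (p k i * q i) * affinity i 1 < Num.sqrt (p k i * q i).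
  by rewrite -[ltRHS]mulr1 ltr_pM2l.
by case: i {lt1}; have := h false; have := h true; lra.
Qed.

Lemma affinity_decay c : 0 <= c -> (forall k, affinity k 2 <= c) ->
  forall n k, affinity k n.*2 <= c ^+ n.
Proof.
move=> c0 hc; elim=> [|n IHn] k; first by rewrite affinity0.
have sq_ge0 j j' : 0 <= Num.sqrt (p j j' * q j') by rewrite sqrtr_ge0.
apply: (@le_trans _ _ (affinity k 2 * c ^+ n)); last first.
  by rewrite exprS ler_wpM2r // exprn_ge0.
rewrite doubleS !affinityS !affinity0 !mulr1 !(mulrDl, mulrDr) !mulrA.
by rewrite !lerD // ler_wpM2l // mulr_ge0.
Qed.

Lemma sum_sqrt_word_mass_le n c : (forall k, affinity k n <= c) ->
  \sum_(w <- words n.+1) Num.sqrt (word_mass p0 p w * iid_mass w) <= c.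
Proof.
move=> hc; have c0 : 0 <= c := le_trans (affinity_ge0 false n) (hc false).
rewrite sum_words /=.
have part i : \sum_(w <- words n) Num.sqrt (p0 i * path_mass p i w * iid_mass (i :: w))
    <= (p0 i + q i) / 2 * c.
  rewrite (eq_bigr (fun w => Num.sqrt (p0 i * q i) *
      Num.sqrt (path_mass p i w * iid_mass w))); last first.
    by move=> w _; rewrite iid_mass_cons mulrACA sqrtrM // mulr_ge0 // ltW.
  rewrite -mulr_sumr ler_pM ?sqrtr_ge0 ?affinity_ge0 //; last exact: hc.
  by rewrite sqrtM_le_mean // ltW.
have := part false; have := part true.
suff : (p0 false + q false) / 2 * c + (p0 true + q true) / 2 * c = c by lra.
by rewrite -mulrDl -mulrDl addrACA p0_sum q_sum; lra.
Qed.

End affinity.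

(** * The chain in terms of words *)

Section bigsetU.
Context d (T : measurableType d) (R : realType) (mu : {measure set T -> \bar R}).

Lemma measure_bigsetU_le (I : Type) (r : seq I) (Q : pred I) (A : I -> set T) :
  (forall i, measurable (A i)) ->
  (mu (\big[setU/set0]_(i <- r | Q i) A i) <= \sum_(i <- r | Q i) mu (A i))%E.
Proof.
move=> mA; elim: r => [|i r IHr]; first by rewrite !big_nil measure0.
rewrite !big_cons; case: ifP => // _.
apply: le_trans (measureU2 _ _ _) _ => //; last exact: leeD.
exact: bigsetU_measurable.
Qed.

End bigsetU.

Section chain.
Context d (T : measurableType d) (R : realType) (P : probability T R).
Variables (tau : nat -> {RV P >-> bool}) (p0 : bool -> R) (p : bool -> bool -> R).
Hypotheses (p0_gt0 : forall i, 0 < p0 i) (htau : is_markov_chain tau p0 p).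

(** The event that the chain starts with [s 0, ..., s n]. *)
Definition past n (s : nat -> bool) : set T :=
  \bigcap_(k in `I_n.+1) visits tau k (s k).

Lemma measurable_visits n i : measurable (visits tau n i).
Proof. by rewrite -[visits _ _ _]setTI; exact: measurable_funP. Qed.

Lemma measurable_past n s : measurable (past n s).
Proof.
by apply: bigcap_measurable => [|k _]; [exists 0%N | exact: measurable_visits].
Qed.

Lemma transition_ge0 i j : 0 <= p i j.
Proof.
have [P0 _ Pp] := htau.
by rewrite -(Pp 0%N) ?P0 ?lte_fin // /cond_prob divr_ge0 // fine_ge0.
Qed.

(** The Markov property says nothing after a past of probability 0, but then
    both sides vanish. *)
Lemma prob_past n s :
  P (past n s) = (p0 (s 0%N) * \prod_(k < n) p (s k) (s k.+1))%:E.
Proof.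
have [P0 Pmarkov Pp] := htau.
elim: n => [|n IHn].
  rewrite big_ord0 mulr1 -P0; congr (P _); apply/seteqP; split => w /=.
    by apply.
  by move=> ws [|k].
have pastS : past n.+1 s = visits tau n.+1 (s n.+1) `&` past n s.
  apply/seteqP; split => w /=.
    by move=> h; split; [apply: h => /= | move=> k /= kn; apply: h => /=; exact: ltnW].
  move=> [ws h] k /=; rewrite ltnS leq_eqVlt => /predU1P[->//|kn]; exact: h.
have mpast := measurable_past n s; have mv := measurable_visits n.+1 (s n.+1).
have [past_gt0|] := ltP 0%E (P (past n s)); last first.
  move=> past_le0; have past0 : P (past n s) = 0%E.
    by apply/eqP; rewrite eq_le past_le0 measure_ge0.
  move: IHn; rewrite past0 big_ord_recr mulrA => -[<-]; rewrite mul0r.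
  apply/eqP; rewrite -measure_le0 -past0 pastS le_measure ?inE //.
  exact: measurableI.
have visits_gt0 : (0 < P (visits tau n (s n)))%E.
  apply: lt_le_trans past_gt0 _; rewrite le_measure ?inE //.
    exact: measurable_visits.
  by move=> w; apply => /=.
have := Pmarkov n s (s n.+1) past_gt0.
move: past_gt0; rewrite Pp // /cond_prob -/(past n s) -pastS IHn lte_fin /=.
move=> past_gt0 /(congr1 (fun x => x * (p0 (s 0%N) * \prod_(k < n) p (s k) (s k.+1)))).
rewrite divfK ?gt_eqF // => fineE.
rewrite -[LHS]fineK ?fineE ?fin_num_measure //; last exact: measurable_past.
by rewrite big_ord_recr /= mulrC -mulrA.
Qed.

(** Union bound over the prefixes of length [n.+1]. *)
Lemma prob_le_word_mass n (Q : pred (seq bool)) (B : set T) : measurable B ->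
  (forall w, B w -> Q (mkseq (tau^~ w) n.+1)) ->
  (P B <= (\sum_(w <- words n.+1 | Q w) word_mass p0 p w)%:E)%E.
Proof.
move=> mB BQ; pose E w := past n (nth false w).
have mE w : measurable (E w) by exact: measurable_past.
apply: (@le_trans _ _ (P (\big[setU/set0]_(w <- words n.+1 | Q w) E w))).
  rewrite le_measure ?inE //; first exact: bigsetU_measurable.
  move=> t Bt; rewrite -bigcup_seq_cond.
  exists (mkseq (tau^~ t) n.+1); last first.
    by move=> k /= kn; rewrite /visits /= nth_mkseq.
  by apply/andP; rewrite mem_words size_mkseq eqxx BQ.
apply: le_trans (measure_bigsetU_le _ _ _ mE) _.
rewrite -sumEFin big_seq_cond [leRHS]big_seq_cond lee_sum // => w /andP[+ _].
rewrite mem_words => /eqP sw.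
suff <- : P (E w) = (word_mass p0 p w)%:E by exact: lexx.
by rewrite prob_past -(word_mass_mkseq p0 p) -sw mkseq_nth.
Qed.

End chain.

(** * Consequences for the law of the random variable *)

Section law.
Context (R : realType) (g0 : R) (hg0 : 2^-1 <= g0 < 1).
Context d (T : measurableType d) (P : probability T R).
Variables (tau : nat -> {RV P >-> bool}) (p0 : bool -> R) (p : bool -> bool -> R).
Hypotheses (p0_gt0 : forall i, 0 < p0 i) (p0_sum : p0 false + p0 true = 1).
Hypothesis p_sum : forall i, p i false + p i true = 1.
Hypothesis htau : is_markov_chain tau p0 p.

Let mu := distribution P (G2_RV tau hg0).
Let g0_gt0 : 0 < g0. Proof. exact: half_le_gt0. Qed.

(** The random variable falls in the cylinder of each prefix of the chain. *)
Lemma law_le_word_mass n (Q : pred (seq bool)) (A : set R) : measurable A ->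
  (forall w x, size w = n.+1 -> A x -> cyl_lo g0 w <= x <= cyl_hi g0 w -> Q w) ->
  (mu A <= (\sum_(w <- words n.+1 | Q w) word_mass p0 p w)%:E)%E.
Proof.
move=> mA AQ; pose B := G2_RV tau hg0 @^-1` A.
apply: (prob_le_word_mass htau (B := B)).
  by rewrite -[B]setTI; exact: measurable_funP.
by move=> t /AQ; apply; [exact: size_mkseq | exact: (G2_in_cylinder hg0 (tau^~ t))].
Qed.

Lemma law_atomless : (forall i j, p i j != 0) -> forall x, mu [set x] = 0%E.
Proof.
move=> p_neq0 x.
have p_gt0 i j : 0 < p i j by rewrite lt0r p_neq0 (transition_ge0 p0_gt0 htau).
have p_ge0 i j := ltW (p_gt0 i j).
(* every transition probability is at most [c], and [c < 1] *)
pose c := Num.max (Num.max (p false false) (p false true))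
                  (Num.max (p true false) (p true true)).
have pc i j : p i j <= c by rewrite /c !le_max; case: i; case: j; rewrite lexx ?orbT.
have c_lt1 : c < 1.
  rewrite /c !gt_max; have := (p_sum false, p_sum true).
  have := (p_gt0 false false, p_gt0 false true).
  have := (p_gt0 true false, p_gt0 true true).
  by move=> [? ?] [? ?] [? ?]; apply/andP; split; apply/andP; split; lra.
have c_ge0 : 0 <= c := le_trans (ltW (p_gt0 false false)) (pc false false).
have mu_le n : (mu [set x] <= (2 * c ^+ n)%:E)%E.
  have := @law_le_word_mass n (fun w => cyl_lo g0 w <= x <= cyl_hi g0 w) _
    (measurable_set1 x).
  move=> /(_ _)/le_trans; apply; first by move=> w y _ ->.
  rewrite lee_fin; apply: (@le_trans _ _ (cyl_count g0 n.+1 x * c ^+ n)).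
    rewrite /cyl_count mulr_suml big_seq_cond [leRHS]big_seq_cond.
    apply: ler_sum => -[|i w] /andP[]; rewrite mem_words // => /eqP[sw] _ /=.
    rewrite ler_pM ?path_mass_ge0 //.
    - exact: ltW.
    - by have := p0_gt0 (~~ i); have := p0_sum; case: i => /=; lra.
    - by rewrite -sw path_mass_le.
  by rewrite ler_wpM2r ?exprn_ge0 // cyl_count_le2.
apply/eqP; rewrite -measure_le0.
have : (2 * c ^+ n)%:E @[n --> \oo] --> (0 : \bar R).
  apply: cvg_EFin; first exact: nearW.
  rewrite -[X in _ --> X](mulr0 2); apply: cvgMr.
  by apply: cvg_expr; rewrite ger0_norm.
by move=> cv; apply: (cvge_ge _ cv); exact: nearW.
Qed.

(** A row of transition probabilities other than [|g_j|] makes the law charge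
    a Lebesgue null set. *)
Lemma law_not_dominated i j : (forall i j, p i j != 0) ->
  p i j != `|gcoef g0 j| -> ~ mu `<< @lebesgue_measure R.
Proof.
move=> p_neq0 pq mu_ac; pose q k := `|gcoef g0 k|.
have p_gt0 k l : 0 < p k l by rewrite lt0r p_neq0 (transition_ge0 p0_gt0 htau).
have q_gt0 k : 0 < q k by exact: gcoef_norm_gt0.
have q_sum : q false + q true = 1.
  by rewrite /q gcoef_norm0 // gcoef_norm1 //; lra.
pose c := Num.max (affinity q p false 2) (affinity q p true 2).
have c_lt1 : c < 1.
  by rewrite gt_max !(affinity2_lt1 q_gt0 q_sum p_gt0 p_sum _ pq).
have hc k : affinity q p k 2 <= c by rewrite le_max; case: k; rewrite lexx ?orbT.
have c_ge0 : 0 <= c := le_trans (affinity_ge0 q p false 2) (hc false).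
pose m := word_mass p0 p; pose l := cyl_ratio g0.
have m_ge0 w : 0 <= m w by apply: word_mass_ge0 => *; exact: ltW.
have sum_sqrt n : \sum_(w <- words n.*2.+1) Num.sqrt (m w * l w) <= c ^+ n.
  apply: (sum_sqrt_word_mass_le q_gt0 q_sum) => // [k|k]; first exact: ltW.
  exact: affinity_decay.
(* The words of [E n] have a small total length, since there [l <= sqrt (m * l)];
   the other ones are unlikely, since there [m <= sqrt (m * l)]. *)
pose E n : set R := \big[setU/set0]_(w <- words n.*2.+1 | l w <= m w)
  `[cyl_lo g0 w, cyl_hi g0 w]%classic.
have mE n : measurable (E n) by apply: bigsetU_measurable => w _; exact: measurable_itv.
have leb_E n : (lebesgue_measure (E n) <= (g0 * c ^+ n)%:E)%E.
  have itvE w : lebesgue_measure `[cyl_lo g0 w, cyl_hi g0 w]%classic =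
      (g0 * l w)%:E.
    have [_ lh _] := cyl_ends_bounds hg0 w.
    rewrite -cyl_length // lebesgue_measure_itv /= lte_fin EFinB.
    by case: ltgtP lh => // -> _; rewrite -EFinB subrr.
  apply: le_trans (measure_bigsetU_le _ _ _ _) _ => [w|]; first exact: measurable_itv.
  rewrite (eq_bigr (fun w => (g0 * l w)%:E)) => [|w _]; last exact: itvE.
  rewrite sumEFin lee_fin -mulr_sumr ler_pM2l //.
  apply: le_trans (sum_sqrt n); rewrite big_mkcond; apply: ler_sum => w _.
  case: ifP => [lm|_]; last exact: sqrtr_ge0.
  rewrite -[leLHS]ger0_norm ?cyl_ratio_ge0 // -sqrtr_sqr ler_wsqrtr //.
  by rewrite expr2 ler_wpM2r ?cyl_ratio_ge0.
have mu_E n : (mu (~` E n) <= (c ^+ n)%:E)%E.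
  have := @law_le_word_mass n.*2 (fun w => m w < l w) _ (measurableC (mE n)).
  move=> /(_ _)/le_trans; apply.
    move=> w x sw nEx xw; rewrite ltNge; apply/negP => lm; apply: nEx.
    rewrite /E -bigcup_seq_cond; exists w; last by rewrite /= in_itv.
    by apply/andP; rewrite mem_words sw eqxx.
  rewrite lee_fin.
  apply: le_trans (sum_sqrt n); rewrite big_mkcond; apply: ler_sum => w _.
  case: ifP => [lm|_]; last exact: sqrtr_ge0.
  rewrite -[leLHS]ger0_norm ?m_ge0 // -sqrtr_sqr ler_wsqrtr //.
  by rewrite expr2 ler_wpM2l ?m_ge0 // ltW.
have mlim : measurable (lim_sup_set E).
  by apply: bigcap_measurable => [|n _]; [exists 0%N | exact: bigcup_measurable].
have leb0 : lebesgue_measure (lim_sup_set E) = 0%E.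
  apply: lim_sup_set_cvg0 => //.
  apply: (@le_lt_trans _ _ (\sum_(n <oo) (g0 * c ^+ n)%:E)%E).
    by apply: lee_nneseries => // n _; exact: leb_E.
  rewrite (_ : (\sum_(n <oo) _)%E = (g0 / (1 - c))%:E) ?ltry //.
  apply/cvg_lim => //; rewrite (_ : (fun _ => _) = EFin \o series (geometric g0 c)).
    apply: cvg_EFin; first exact: nearW.
    by apply: cvg_geometric_series; rewrite ger0_norm.
  by apply/funext => n; rewrite /= sumEFin.
have mu0 : mu (lim_sup_set E) = 0%E.
  have [_ null] := measure0_null_setP lebesgue_measure mlim.
  exact: (mu_ac _ (null leb0)).
have mtail n : measurable (\bigcup_(k >= n) E k) by exact: bigcup_measurable.
have tail : mu (\bigcup_(k >= n) E k) @[n --> \oo] --> 0%E.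
  rewrite -mu0; apply: lim_sup_set_cvg => //.
  by rewrite (le_lt_trans (probability_le1 _ (mtail 0%N))) ?ltry.
have c_cvg : (c ^+ n)%:E @[n --> \oo] --> (0 : \bar R).
  apply: cvg_EFin; first exact: nearW.
  by apply: cvg_expr; rewrite ger0_norm.
(* The tails would have measure tending to 0, but they contain the sets [E n],
   of probability at least [1 - c ^+ n]. *)
have : (1 <= 0 :> \bar R)%E; last by rewrite lee_fin ler10.
have sum_cvg : (mu (\bigcup_(k >= n) E k) + (c ^+ n)%:E)%E @[n --> \oo] --> 0%E.
  by rewrite -[X in _ --> X]adde0; apply: cvgeD.
apply: (cvge_ge _ sum_cvg); apply: nearW => n.
rewrite -(probability_setT mu) -(setUv (E n)).
apply: le_trans (measureU2 mu (mE n) (measurableC (mE n))) _.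
apply: leeD; last exact: mu_E.
by rewrite le_measure ?inE // => x Ex; exists n => /=.
Qed.

End law.

(** * The uniform case *)

Section uniform.
Context (R : realType).

(** Bounds on both sides of every point of [0, b] that add up to 1 determine
    the tails of a probability on the line. *)
Lemma tail_uniform (b : R) (nu : probability R R) : 0 < b ->
  (forall a : R, 0 <= a <= b -> (nu `]-oo, a]%classic <= (a / b)%:E)%E) ->
  (forall a : R, 0 <= a <= b -> (nu `]a, +oo[%classic <= ((b - a) / b)%:E)%E) ->
  forall a : R, nu `]a, +oo[%classic =
    (if a < 0 then 1 else if a <= b then (b - a) / b else 0)%:E.
Proof.
move=> b0 below above a.
have nuC : nu `]a, +oo[%classic = (1 - nu `]-oo, a]%classic)%E.
  by rewrite -setCitvl probability_setC.
case: ifPn => [a0|]; last rewrite -leNgt => a0.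
  rewrite nuC (_ : nu `]-oo, a]%classic = 0%E) ?sube0 //.
  apply/eqP; rewrite -measure_le0; have := below 0.
  rewrite mul0r lexx ltW // => /(_ isT).
  apply: le_trans; rewrite le_measure ?inE //; apply: subset_itvl.
  by rewrite bnd_simp ltW.
case: ifPn => [ab|]; last rewrite -ltNge => ba.
  apply/eqP; rewrite eq_le above ?a0 //= nuC.
  rewrite mulrBl divff ?gt_eqF // EFinB leeB //.
  by rewrite below // a0 ab.
apply/eqP; rewrite -measure_le0; have := above b.
rewrite subrr mul0r lexx ltW // => /(_ isT).
apply: le_trans; rewrite le_measure ?inE //; apply: subset_itvr.
by rewrite bnd_simp ltW.
Qed.

(** Both types below carry the Borel sigma-algebra of the line, under two
    different displays. *)
Lemma eq_probability_tail (m1 : probability R R)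
    (m2 : probability (measurableTypeR R) R) :
  (forall a : R, m1 `]a, +oo[%classic = m2 `]a, +oo[%classic) ->
  forall A : set R, measurable A -> m1 A = m2 A.
Proof.
move=> m12 A mA.
pose m2' : {measure set R -> \bar R} := HB.pack (m2 : set R -> \bar R)
  (isMeasure.Build _ R R (m2 : set R -> \bar R) (measure0 m2)
    (measure_ge0 m2) (@measure_semi_sigma_additive _ _ _ m2)).
apply: (@measure_unique _ R R (@RGenOInfty.G R)
  (fun n => `]- n%:R, +oo[%classic) _ _ _ _ m1 m2') => //.
- exact: RGenOInfty.measurableE.
- move=> _ _ [x ->] [y ->]; exists (Num.max x y).
  apply/seteqP; split => z /=; rewrite !in_itv /= !andbT gt_max.
    by move=> [-> ->].
  by move=> /andP[].
- by move=> n; exists (- n%:R).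
- rewrite -subTset => x _; exists (Num.truncn `|x|).+1 => //=.
  rewrite in_itv /= andbT ltrNl (le_lt_trans (ler_norm _)) // normrN.
  exact: truncnS_gt.
- by move=> _ [x ->]; exact: m12.
- by move=> k; rewrite (le_lt_trans (probability_le1 _ _)) ?ltry.
Qed.

Lemma uniform_probE (b : R) (b0 : 0 < b) (A : set R) : measurable A ->
  uniform_prob b0 A = ((b^-1)%:E * lebesgue_measure (A `&` `[0%R, b]%classic))%E.
Proof.
move=> mA; rewrite /uniform_prob integral_uniform_pdf.
rewrite (eq_integral (fun=> (b^-1)%:E)) ?integral_cst //.
  by apply: measurableI.
by move=> x /set_mem[_ /=]; rewrite in_itv /uniform_pdf /= subr0 => ->.
Qed.

Lemma tail_uniform_prob (b : R) (b0 : 0 < b) a : uniform_prob b0 `]a, +oo[%classic =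
  (if a < 0 then 1 else if a <= b then (b - a) / b else 0)%:E.
Proof.
rewrite uniform_probE //.
case: ifPn => [a0|]; last rewrite -leNgt => a0.
  rewrite (_ : _ `&` _ = `[0%R, b]%classic); last first.
    apply/seteqP; split => x /=; rewrite !in_itv /= andbT.
      by case.
    by move=> /andP[x0 xb]; rewrite x0 xb (lt_le_trans a0).
  by rewrite lebesgue_measure_itv /= lte_fin b0 sube0 -EFinM mulVf ?gt_eqF.
have -> : `]a, +oo[%classic `&` `[0, b]%classic = `]a, b]%classic :> set R.
  apply/seteqP; split => x /=; rewrite !in_itv /= andbT.
    by move=> [-> /andP[_ ->]].
  by move=> /andP[ax xb]; rewrite ax xb (le_trans a0 (ltW ax)).
rewrite lebesgue_measure_itv /= lte_fin; case: ltgtP => ab.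
- by rewrite -EFinD -EFinM mulrC.
- by rewrite mule0.
- by rewrite mule0 ab subrr mul0r.
Qed.

End uniform.

Section uniform_law.
Context (R : realType) (g0 : R) (hg0 : 2^-1 <= g0 < 1).
Context d (T : measurableType d) (P : probability T R).
Variables (tau : nat -> {RV P >-> bool}) (p0 : bool -> R) (p : bool -> bool -> R).
Hypotheses (p0_sum : p0 false + p0 true = 1).
Hypothesis htau : is_markov_chain tau p0 p.
Hypotheses (pE : forall i j, p i j = `|gcoef g0 j|) (p0E : p0 false = g0).

Let mu := distribution P (G2_RV tau hg0).
Let g0_gt0 : 0 < g0. Proof. exact: half_le_gt0. Qed.

Lemma word_mass_uniform w : word_mass p0 p w = cyl_ratio g0 w.
Proof.
have path i v : path_mass p i v = cyl_ratio g0 v.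
  elim: v i => [|j v IHv] i /=; first by rewrite cyl_ratio_nil.
  by rewrite IHv pE cyl_ratio_cons.
case: w => [|i w] /=; first by rewrite cyl_ratio_nil.
rewrite path cyl_ratio_cons; congr (_ * _); case: i.
  by rewrite gcoef_norm1 // -p0_sum p0E addrC addKr.
by rewrite gcoef_norm0.
Qed.

Lemma le_geometric_error (x : \bar R) (r : R) :
  (forall n, (x <= (r + g0 ^+ n.+1)%:E)%E) -> (x <= r%:E)%E.
Proof.
move=> hx; have cv : (r + g0 ^+ n.+1)%:E @[n --> \oo] --> r%:E.
  apply: cvg_EFin; first exact: nearW.
  rewrite -[X in _ --> X]addr0; apply: cvgD; first exact: cvg_cst.
  rewrite (cvg_shiftS (fun n => g0 ^+ n)); apply: cvg_expr.
  by rewrite ger0_norm ?(ltW g0_gt0) //; case/andP: hg0.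
by apply: (cvge_ge _ cv); exact: nearW.
Qed.

Lemma law_uniform A : measurable A -> mu A = uniform_prob (half_le_gt0 hg0) A.
Proof.
pose nu : probability R R := distribution P (G2_RV tau hg0).
apply: (@eq_probability_tail _ nu (uniform_prob (half_le_gt0 hg0))) => a.
rewrite [RHS]tail_uniform_prob.
apply: (tail_uniform (nu := nu)) => // {}a a01.
  apply: le_geometric_error => n.
  have := law_le_word_mass hg0 htau (n := n) (Q := fun w => cyl_lo g0 w <= a)
    (A := `]-oo, a]%classic) (measurable_itv _).
  move=> /(_ _)/le_trans; apply.
    by move=> w x _ /=; rewrite in_itv /= => xa /andP[lx _]; exact: le_trans xa.
  rewrite lee_fin (eq_bigr (cyl_ratio g0)) => [|w _]; last exact: word_mass_uniform.
  by have [] := cyl_ratio_below_above hg0 n.+1 a01.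
apply: le_geometric_error => n.
have := law_le_word_mass hg0 htau (n := n) (Q := fun w => a <= cyl_hi g0 w)
  (A := `]a, +oo[%classic) (measurable_itv _).
move=> /(_ _)/le_trans; apply.
  move=> w x _ /=; rewrite in_itv /= andbT => ax /andP[_ xh].
  exact: le_trans (ltW ax) xh.
rewrite lee_fin (eq_bigr (cyl_ratio g0)) => [|w _]; last exact: word_mass_uniform.
by have [] := cyl_ratio_below_above hg0 n.+1 a01.
Qed.

End uniform_law.

Theorem theorem10 (R : realType) (g0 : R) (hg0 : 2^-1 <= g0 < 1)
    (d : measure_display) (T : measurableType d) (P : probability T R)
    (tau : nat -> {RV P >-> bool})
    (p0 : bool -> R) (p : bool -> bool -> R)
    (p0_gt0 : forall i, 0 < p0 i) (p0_sum : p0 false + p0 true = 1)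
    (p_sum : forall i, p i false + p i true = 1)
    (htau : is_markov_chain tau p0 p) :
  let mu := distribution P (G2_RV tau hg0) in
  ((forall i j, p i j != 0) ->
     (forall x, mu [set x] = 0%E) /\
     (mu `<< @lebesgue_measure R -> forall i j, p i j = `|gcoef g0 j|)) /\
  ((forall i j, p i j = `|gcoef g0 j|) -> p0 false = g0 ->
     forall A, measurable A -> mu A = uniform_prob (half_le_gt0 hg0) A).
Proof.
move=> mu; split => [p_neq0|pE p0E A mA]; last exact: law_uniform htau pE p0E _ mA.
split => [x|mu_ac i j]; first exact: law_atomless htau p_neq0 x.
apply: contrapT => /eqP pq.
exact: law_not_dominated htau i j p_neq0 pq mu_ac.
Qed.
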